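(* Let $I\subset\mathbb{R}$ be an open interval and let $\alpha:I\to\mathbf{E}_1^3$ be a unit speed timelike curve whose curvature $\kappa$ and torsion $\tau$ vanish nowhere on $I$, and suppose that $\tau^2-\kappa^2$ vanishes nowhere on $I$. Then $\alpha$ is a slant helix if and only if one of the two functions $$\frac{\kappa^2}{(\tau^2-\kappa^2)^{3/2}}\Big(\frac{\tau}{\kappa}\Big)'\qquad\text{or}\qquad \frac{\kappa^2}{(\kappa^2-\tau^2)^{3/2}}\Big(\frac{\tau}{\kappa}\Big)'$$ is constant on $I$ (the first function is the one that is defined when $\tau^2>\kappa^2$ on $I$, the second when $\tau^2<\kappa^2$ on $I$).
   Context: Minkowski 3-space $\mathbf{E}_1^3$ is $\mathbb{R}^3$ with the metric $\langle\,,\rangle=dx_1^2+dx_2^2-dx_3^2$. A vector $v$ is spacelike if $\langle v,v\rangle>0$ or $v=0$, timelike if $\langle v,v\rangle<0$, lightlike if $\langle v,v\rangle=0$ and $v\ne0$; $\|v\|=\sqrt{|\langle v,v\rangle|}$. The vector product is defined by $\langle u\times v,w\rangle=\det(u,v,w)$ for all $w$. Curves are smooth and regular. A curve is timelike if all its velocity vectors are timelike; it is unit speed if $\|\alpha'(s)\|=1$ for all $s$. Frenet frame of a unit speed timelike curve (with $\alpha''$ nowhere zero): $\mathbf{T}=\alpha'$, $\mathbf{N}=\alpha''/\|\alpha''\|$, $\mathbf{B}=\mathbf{T}\times\mathbf{N}$. The curvature $\kappa$ and torsion $\tau$ are the functions determined by the Frenet equations $$\mathbf{T}'=\kappa\mathbf{N},\quad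 \mathbf{N}'=\kappa\mathbf{T}+\tau\mathbf{B},\quad \mathbf{B}'=-\tau\mathbf{N}.$$ A unit speed curve $\alpha$ is a slant helix if there exists a constant nonzero vector $U\in\mathbf{E}_1^3$ such that the function $s\mapsto\langle\mathbf{N}(s),U\rangle$ is constant on $I$. A prime denotes $d/ds$. *)

(* Defs.v *)
From HB Require Import structures.
From mathcomp Require Import all_boot all_order all_algebra.
From mathcomp Require Import all_classical all_reals all_analysis.
From mathcomp Require Import ring.

Set Implicit Arguments.
Unset Strict Implicit.
Unset Printing Implicit Defensive.

Import Order.TTheory GRing.Theory Num.Theory.
Import numFieldNormedType.Exports.

Local Open Scope ring_scope.
Local Open Scope classical_set_scope.

Section Minkowski3.
Context {R : realType}.
Implicit Types u v w : 'rV[R]_3.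

(* The coordinates x_1, x_2, x_3 are the entries of index 0, 1, 2. *)
Definition mdot u v : R :=
  u 0 0 * v 0 0 + u 0 1 * v 0 1 - u 0 2%:R * v 0 2%:R.

Definition mnorm u : R := Num.sqrt `|mdot u u|.

Definition timelike u : Prop := mdot u u < 0.

Definition mcross u v : 'rV[R]_3 :=
  \row_(j < 3) [:: u 0 1 * v 0 2%:R - u 0 2%:R * v 0 1;
                   u 0 2%:R * v 0 0 - u 0 0 * v 0 2%:R;
                   u 0 1 * v 0 0 - u 0 0 * v 0 1]`_j.

(* The defining property of the vector product; the form is nondegenerate, so
   it determines [mcross u v]. *)
Lemma mdot_mcross u v w :
  mdot (mcross u v) w = \det (\matrix_(i < 3, j < 3) [:: u; v; w]`_i 0 j).
Proof.
have rowE (x : 'rV[R]_3) : exists a : nat -> R, x = \row_(j < 3) a j.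
  by exists (fun k => x 0 (inord k)); apply/rowP => j; rewrite mxE inord_val.
have [a ->] := rowE u; have [b ->] := rowE v; have [c ->] := rowE w.
rewrite (expand_det_row _ 0) !big_ord_recl !big_ord0 /cofactor.
rewrite !(expand_det_row _ 0) !big_ord_recl !big_ord0 /cofactor.
rewrite !det_mx11 /mdot /mcross !mxE /=.
rewrite /bump /= -[(1 %% 3)%N]/1%N -[((1 + 1) %% 3)%N]/2%N.
ring.
Qed.

End Minkowski3.

Section Curves.
Context {R : realType}.
Implicit Types (I : set R) (a : R -> 'rV[R]_3) (kappa tau : R -> R).

(* A curve on an open set [I] is given by a total function of which only the
   values on [I] matter: every derivative below is taken at a point of [I] and
   depends only on the germ of [a] there. *)
Definition smooth_on I a : Prop :=
  forall (n : nat) (s : R), I s -> derivable (a^`(n)) s 1.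

Definition regular_curve I a : Prop :=
  smooth_on I a /\ forall s, I s -> a^`() s != 0.

Definition timelike_curve I a : Prop :=
  regular_curve I a /\ forall s, I s -> timelike (a^`() s)%classic.

Definition unit_speed I a : Prop := forall s, I s -> mnorm (a^`() s)%classic = 1.

Definition frenetT a : R -> 'rV[R]_3 := a^`().

Definition frenetN a : R -> 'rV[R]_3 :=
  fun s => (mnorm (a^`(2) s)%classic)^-1 *: (a^`(2) s)%classic.

Definition frenetB a : R -> 'rV[R]_3 :=
  fun s => mcross (frenetT a s) (frenetN a s).

(* [kappa] and [tau] are the curvature and torsion of the unit speed timelike
   curve [a] on [I]. The first clause is what makes the frame well defined:
   [a^`(2) s] is orthogonal to a timelike vector, hence it is spacelike, and
   when it is nonzero so is its norm. *)
Definition curvature_torsion I a kappa tau : Prop :=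
  forall s, I s ->
    [/\ a^`(2) s != 0,
        (frenetT a)^`() s = kappa s *: frenetN a s,
        (frenetN a)^`() s = kappa s *: frenetT a s + tau s *: frenetB a s
      & (frenetB a)^`() s = - tau s *: frenetN a s].

Definition constant_on I (f : R -> R) : Prop :=
  exists c : R, forall s, I s -> f s = c.

Definition slant_helix I a : Prop :=
  exists U : 'rV[R]_3, U != 0 /\ constant_on I (fun s => mdot (frenetN a s) U).

End Curves.

(* Main.v *)
(** Write [a = <T, U>], [b = <B, U>] and [D = e (tau^2 - kappa^2) > 0] with
    [e = 1] or [e = -1]. If [<N, U> = c] is constant, then [a' = kappa c],
    [b' = - tau c] and, from [N'], [kappa a + tau b = 0]. Hence [a^2 - b^2] is
    constant and equals [e g^2] for [g = (a / tau) sqrt D], which vanishes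
    nowhere (otherwise [U = 0]), so [g] is constant; differentiating
    [kappa a + tau b = 0] identifies the invariant with [- e c / g].
    Conversely, if the invariant is a constant [c], then with
    [lam = 1 / sqrt D] the vector
    [U = - tau lam T - e c N - kappa lam B] has derivative zero and
    [<N, U> = - e c]. *)

Require Import Defs.
From HB Require Import structures.
From mathcomp Require Import all_boot all_order all_algebra.
From mathcomp Require Import all_classical all_reals all_analysis.
From mathcomp Require Import ring lra.

Set Implicit Arguments.
Unset Strict Implicit.
Unset Printing Implicit Defensive.

Import Order.TTheory GRing.Theory Num.Theory.
Import numFieldNormedType.Exports.

Local Open Scope ring_scope.
Local Open Scope classical_set_scope.

(** * Algebra of the Lorentzian scalar and vector products *)

Section MinkowskiAlgebra.
Context {R : realType}.
Implicit Types u v w : 'rV[R]_3.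

Lemma ord3P (P : 'I_3 -> Prop) : P 0 -> P 1 -> P 2%:R -> forall j, P j.
Proof.
move=> P0 P1 P2 [[|[|[|//]]] j3].
- by rewrite (_ : Ordinal j3 = 0) //; exact: val_inj.
- by rewrite (_ : Ordinal j3 = 1) //; exact: val_inj.
- by rewrite (_ : Ordinal j3 = 2%:R) //; exact: val_inj.
Qed.

Lemma row3P u v :
  u 0 0 = v 0 0 -> u 0 1 = v 0 1 -> u 0 2%:R = v 0 2%:R -> u = v.
Proof. by move=> *; apply/rowP; exact: ord3P. Qed.

Lemma mcrossE u v :
  (mcross u v 0 0 = u 0 1 * v 0 2%:R - u 0 2%:R * v 0 1) *
  (mcross u v 0 1 = u 0 2%:R * v 0 0 - u 0 0 * v 0 2%:R) *
  (mcross u v 0 2%:R = u 0 1 * v 0 0 - u 0 0 * v 0 1).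
Proof. by rewrite !mxE. Qed.

Lemma mdotC u v : mdot u v = mdot v u.
Proof. by rewrite /mdot; ring. Qed.

Lemma mdotDl u v w : mdot (u + v) w = mdot u w + mdot v w.
Proof. by rewrite /mdot !mxE; ring. Qed.

Lemma mdotZl (k : R) u v : mdot (k *: u) v = k * mdot u v.
Proof. by rewrite /mdot !mxE; ring. Qed.

Lemma mdotDr u v w : mdot w (u + v) = mdot w u + mdot w v.
Proof. by rewrite /mdot !mxE; ring. Qed.

Lemma mdotZr (k : R) u v : mdot v (k *: u) = k * mdot v u.
Proof. by rewrite /mdot !mxE; ring. Qed.

Lemma mdot_crossl u v : mdot u (mcross u v) = 0.
Proof. by rewrite /mdot !mcrossE; ring. Qed.

Lemma mdot_crossr u v : mdot v (mcross u v) = 0.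
Proof. by rewrite /mdot !mcrossE; ring. Qed.

(** Lagrange's identity; the Lorentzian signature reverses the Euclidean sign. *)
Lemma mdot_cross_cross u v :
  mdot (mcross u v) (mcross u v) = mdot u v ^+ 2 - mdot u u * mdot v v.
Proof. by rewrite /mdot !mcrossE; ring. Qed.

(** The triple product expansion, again with the sign opposite to the Euclidean one. *)
Lemma mcross_crossl u v w :
  mcross (mcross u v) w = mdot v w *: u - mdot u w *: v.
Proof. by apply: row3P; rewrite !(mcrossE, mxE) /mdot; ring. Qed.


(** With [b] the product of [u] and [v], the triple product expansion kills [mcross b w]. Expanding
    [mcross (mcross b w) b] then leaves [- mdot b b *: w = 0]. *)
Lemma orthogonal_frame_eq0 u v w :
  mdot (mcross u v) (mcross u v) != 0 ->
  mdot u w = 0 -> mdot v w = 0 -> mdot (mcross u v) w = 0 -> w = 0.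
Proof.
set b := mcross u v => bb uw vw bw.
have bxw : mcross b w = 0 by rewrite mcross_crossl uw vw !scale0r subrr.
have : mcross (mcross b w) b = 0.
  by rewrite bxw; apply: row3P; rewrite !mcrossE !mxE; ring.
rewrite (mcross_crossl b w b) [mdot w b]mdotC bw scale0r sub0r => /eqP.
by rewrite oppr_eq0 scaler_eq0 (negbTE bb) => /eqP.
Qed.

(** Multiplying [mdot v v] by the square of the third coordinate of [u] and substituting the
    orthogonality relation gives a sum of two nonnegative terms ([key]). *)
Lemma orthogonal_timelike_gt0 u v :
  timelike u -> mdot u v = 0 -> v != 0 -> 0 < mdot v v.
Proof.
rewrite /timelike => u_lt0 uv0 v_neq0.
have uvE : u 0 2%:R * v 0 2%:R = u 0 0 * v 0 0 + u 0 1 * v 0 1.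
  by move: uv0; rewrite /mdot; lra.
have key : u 0 2%:R ^+ 2 * mdot v v =
    - mdot u u * (v 0 0 ^+ 2 + v 0 1 ^+ 2)
    + (u 0 0 * v 0 1 - u 0 1 * v 0 0) ^+ 2.
  have : (u 0 2%:R * v 0 2%:R) ^+ 2 = (u 0 0 * v 0 0 + u 0 1 * v 0 1) ^+ 2.
    by rewrite uvE.
  by rewrite /mdot => E; ring: E.
have uz : 0 < u 0 2%:R ^+ 2 by move: u_lt0; rewrite /mdot; nra.
rewrite -(pmulr_rgt0 _ uz) key ltr_wpDr ?sqr_ge0// pmulr_rgt0 ?oppr_gt0//.
rewrite lt_neqAle addr_ge0 ?sqr_ge0// andbT eq_sym.
(* Strictness: if the first two coordinates of [v] vanish, orthogonality kills the third, since that
   of [u] is nonzero. *)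
apply: contra_neq v_neq0 => /eqP.
rewrite paddr_eq0 ?sqr_ge0// !sqrf_eq0 => /andP[/eqP v0 /eqP v1].
have /eqP := uvE; rewrite v0 v1 !mulr0 addr0 mulf_eq0.
rewrite -sqrf_eq0 gt_eqF//= => /eqP v2.
by apply: row3P; rewrite ?mxE.
Qed.

End MinkowskiAlgebra.

(** * Differentiation rules for scalar and row-vector functions *)

Section Calculus.
Context {R : realType}.
Implicit Types (f g : R -> R) (u v : R -> 'rV[R]_3) (s : R).

Lemma is_derive_rowP u s (d : 'rV[R]_3) :
  is_derive s 1 u d <-> forall j, is_derive s 1 (fun t => u t 0 j) (d 0 j).
Proof.
split=> [[du <-] j|du].
  have /derivable_mxP duc := du.
  by rewrite derive_mx// mxE; apply: DeriveDef; [exact: duc|].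
have du' : derivable u s 1.
  by apply/derivable_mxP => i j; rewrite ord1; have [] := du j.
apply: DeriveDef; first by [].
by apply/rowP => j; rewrite derive_mx// mxE; have [_ <-] := du j.
Qed.

Lemma is_derive_mul f g s (df dg : R) :
  is_derive s 1 f df -> is_derive s 1 g dg ->
  is_derive s 1 (fun t => f t * g t) (df * g s + f s * dg).
Proof.
move=> ? ?; apply: (is_derive_eq (is_deriveM _ _)).
by rewrite addrC [df * _]mulrC.
Qed.

Lemma is_derive_sqr f s (df : R) :
  is_derive s 1 f df -> is_derive s 1 (fun t => f t ^+ 2) (2 * f s * df).
Proof.
by move=> f'; apply: (is_derive_eq (is_derive_mul f' f')); ring.
Qed.

Lemma is_derive_scale f u s (df : R) (du : 'rV[R]_3) :
  is_derive s 1 f df -> is_derive s 1 u du ->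
  is_derive s 1 (fun t => f t *: u t) (df *: u s + f s *: du).
Proof.
move=> f' /is_derive_rowP u'; apply/is_derive_rowP => j.
under eq_fun do rewrite mxE.
by rewrite !mxE; exact: is_derive_mul.
Qed.

Lemma is_derive_mdot u v s (du dv : 'rV[R]_3) :
  is_derive s 1 u du -> is_derive s 1 v dv ->
  is_derive s 1 (fun t => mdot (u t) (v t)) (mdot du (v s) + mdot (u s) dv).
Proof.
move=> /is_derive_rowP u' /is_derive_rowP v'; rewrite /mdot.
pose m j := is_derive_mul (u' j) (v' j).
apply: (is_derive_eq (is_deriveB (is_deriveD (m 0) (m 1)) (m 2%:R))).
ring.
Qed.

Lemma is_derive_mcross u v s (du dv : 'rV[R]_3) :
  is_derive s 1 u du -> is_derive s 1 v dv ->
  is_derive s 1 (fun t => mcross (u t) (v t))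
    (mcross du (v s) + mcross (u s) dv).
Proof.
move=> /is_derive_rowP u' /is_derive_rowP v'; apply/is_derive_rowP.
pose m i j := is_derive_mul (u' i) (v' j).
apply: ord3P; under eq_fun do rewrite mcrossE.
- apply: (is_derive_eq (is_deriveB (m 1 2%:R) (m 2%:R 1))).
  by rewrite [RHS]mxE !mcrossE; ring.
- apply: (is_derive_eq (is_deriveB (m 2%:R 0) (m 0 2%:R))).
  by rewrite [RHS]mxE !mcrossE; ring.
- apply: (is_derive_eq (is_deriveB (m 1 0) (m 0 1))).
  by rewrite [RHS]mxE !mcrossE; ring.
Qed.

Lemma is_derive_continuous f s (df : R) :
  is_derive s 1 f df -> {for s, continuous f}.
Proof. by move=> [df' _]; apply/differentiable_continuous/derivable1_diffP. Qed.

Section Interval.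

(** * Mean value and intermediate value arguments on an interval *)

Variable I : set R.
Hypothesis I_itv : is_interval I.

Lemma itv_segment (a b x : R) : I a -> I b -> x \in `[a, b]%R -> I x.
Proof. by rewrite in_itv /= => Ia Ib; exact: I_itv. Qed.

Lemma itv_within_continuous f (a b : R) :
  (forall s, I s -> {for s, continuous f}) -> I a -> I b ->
  {within `[a, b], continuous f}.
Proof.
move=> fc Ia Ib; apply/continuous_in_subspaceT => x /[1!inE] xab.
exact/fc/(itv_segment Ia Ib).
Qed.

Lemma derive0_constant_on f :
  (forall s, I s -> is_derive s 1 f 0) ->
  forall a b, I a -> I b -> f a = f b.
Proof.
move=> f'; suff le a b : a <= b -> I a -> I b -> f a = f b.
  move=> a b Ia Ib; have [ab|/ltW ba] := leP a b; first exact: le.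
  exact/esym/le.
move=> ab Ia Ib; rewrite -(subKr (f b) (f a)).
have [x /subset_itv_oo_cc xab||c _ ->] := @MVT_segment _ f (cst 0) a b ab.
- exact/f'/(itv_segment Ia Ib).
- by apply: itv_within_continuous => // x /f'/is_derive_continuous.
- by rewrite mul0r subr0.
Qed.

Lemma continuous_neq0_sign f :
  (forall s, I s -> {for s, continuous f}) -> (forall s, I s -> f s != 0) ->
  (forall s, I s -> 0 < f s) \/ (forall s, I s -> f s < 0).
Proof.
move=> fc f0.
have same_sign a b : I a -> I b -> 0 < f a -> 0 < f b.
  move=> Ia Ib fa; rewrite ltNge; apply/negP => fb.
  have fab : Num.min (f a) (f b) <= 0 <= Num.max (f a) (f b).
    by rewrite ge_min le_max fb orbT (ltW fa).
  have [ab|/ltW ba] := leP a b.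
    have [c cab] := IVT ab (itv_within_continuous fc Ia Ib) fab.
    by apply/eqP/f0/(itv_segment Ia Ib).
  rewrite minC maxC in fab.
  have [c cab] := IVT ba (itv_within_continuous fc Ib Ia) fab.
  by apply/eqP/f0/(itv_segment Ib Ia).
(* By the intermediate value theorem, positivity at one point spreads to all of [I]. *)
have [[a [Ia fa]]|nofpos] := pselect (exists a, I a /\ 0 < f a).
  by left => s Is; exact: same_sign fa.
right => s Is; rewrite lt_neqAle f0//= leNgt; apply/negP => fs.
by apply: nofpos; exists s.
Qed.

End Interval.
End Calculus.

(** * Regularity and orthonormality of the Frenet frame *)

Section FrenetFrame.
Context {R : realType}.
Implicit Types (I : set R) (a T N B : R -> 'rV[R]_3) (kappa tau : R -> R) (s : R).

(** Strengthens [curvature_torsion], whose equations only compare values of derivatives, by genuine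
    derivability of the frame, of [kappa] and of [tau]. *)
Definition frenet_frame I T N B kappa tau : Prop :=
  forall s, I s ->
  [/\ [/\ is_derive s 1 T (kappa s *: N s),
          is_derive s 1 N (kappa s *: T s + tau s *: B s)
        & is_derive s 1 B (- tau s *: N s)],
      derivable kappa s 1, derivable tau s 1, B s = mcross (T s) (N s)
    & [/\ mdot (T s) (T s) = -1, mdot (N s) (N s) = 1 & mdot (T s) (N s) = 0]].

Lemma near_is_derive (V : normedModType R) I (f g : R -> V) s (d : V) :
  open I -> I s -> (forall t, I t -> f t = g t) ->
  is_derive s 1 f d -> is_derive s 1 g d.
Proof.
move=> oI Is fg; apply: near_eq_is_derive.
by apply: filterS (open_nbhs_nbhs (conj oI Is)) => t; exact: fg.
Qed.

Lemma near_derivable (V : normedModType R) I (f g : R -> V) s (d : V) :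
  open I -> I s -> (forall t, I t -> f t = g t) ->
  is_derive s 1 f d -> derivable g s 1.
Proof. by move=> oI Is fg /(near_is_derive oI Is fg)[]. Qed.

Lemma is_derive_unique (V : normedModType R) (f : R -> V) s (d e : V) :
  is_derive s 1 f d -> is_derive s 1 f e -> d = e.
Proof. by move=> [_ <-] [_ <-]. Qed.

Lemma derivable_is_derive1 (V : normedModType R) (f : R -> V) s :
  derivable f s 1 -> is_derive s 1 f (f^`() s).
Proof. by rewrite derive1E; exact: derivableP. Qed.

(** Derivability is drawn from the smoothness of [a]: on [I], [kappa] is the norm of the second
    derivative, [N] is that derivative over [kappa], and [tau] is expressed through the third
    derivative and [B]. The Frenet equations then supply the values. *)
Lemma frenet_frameP I a kappa tau : open I ->
  timelike_curve I a -> unit_speed I a -> curvature_torsion I a kappa tau ->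
  (forall s, I s -> kappa s != 0) ->
  frenet_frame I (frenetT a) (frenetN a) (frenetB a) kappa tau.
Proof.
move=> oI [[smooth _] tl] us ct k0.
set T := frenetT a; set N := frenetN a; set B := frenetB a.
pose a2 := a^`(2); pose a3 := a^`(3).
have a2E : a2 = T^`() by rewrite /a2 derive1nS derive1n1.
have T' s : I s -> is_derive s 1 T (a2 s).
  move=> Is; rewrite a2E; apply: derivable_is_derive1.
  by have := smooth 1%N s Is; rewrite derive1n1.
have a2' s : I s -> is_derive s 1 a2 (a3 s).
  by move=> Is; rewrite /a3 derive1nS; exact/derivable_is_derive1/smooth.
have TT s : I s -> mdot (T s) (T s) = -1.
  move=> Is; have := us s Is; have := tl s Is; rewrite /timelike /mnorm => lt0.
  rewrite ltr0_norm// => /(congr1 (fun x => x ^+ 2)).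
  by rewrite sqr_sqrtr ?oppr_ge0 ?ltW// expr1n => <-; rewrite opprK.
have Ta2 s : I s -> mdot (T s) (a2 s) = 0.
  (* [mdot (T t) (T t)] is the constant -1 on the open set [I], so its derivative, twice
     [mdot (T s) (a2 s)], is zero. *)
  move=> Is; have TT' := is_derive_mdot (T' s Is) (T' s Is).
  have TT0 : is_derive s 1 (fun t => mdot (T t) (T t)) 0.
    apply: near_is_derive oI Is _ (is_derive_cst (-1 : R) s 1) => t It.
    exact/esym/TT.
  have := is_derive_unique TT' TT0.
  by rewrite [mdot (a2 s) _]mdotC -mulr2n => /eqP; rewrite mulrn_eq0 => /eqP.
have a2_gt0 s : I s -> 0 < mdot (a2 s) (a2 s).
  move=> Is; have [a20 _ _ _] := ct s Is.
  exact: orthogonal_timelike_gt0 (tl s Is) (Ta2 s Is) a20.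
pose n s := mnorm (a2 s).
have nE s : I s -> n s = Num.sqrt (mdot (a2 s) (a2 s)).
  by move=> Is; rewrite /n /mnorm gtr0_norm ?a2_gt0.
have n_gt0 s : I s -> 0 < n s by move=> Is; rewrite nE// sqrtr_gt0 a2_gt0.
have n2E s : I s -> mdot (a2 s) (a2 s) = n s ^+ 2.
  by move=> Is; rewrite nE// sqr_sqrtr// ltW// a2_gt0.
have NE s : N s = (n s)^-1 *: a2 s by [].
have NN s : I s -> mdot (N s) (N s) = 1.
  move=> Is; rewrite NE mdotZl mdotZr n2E//; field.
  by rewrite gt_eqF ?n_gt0.
have TN s : I s -> mdot (T s) (N s) = 0.
  by move=> Is; rewrite NE mdotZr Ta2// mulr0.
have a2N s : I s -> a2 s = kappa s *: N s.
  by move=> Is; have [_ + _ _] := ct s Is; rewrite a2E.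
(* Pairing the first Frenet equation with [N] identifies [kappa] with the norm [n], hence makes it
   positive. *)
have kn s : I s -> kappa s = n s.
  move=> Is; have := a2N s Is => /(congr1 (mdot^~ (N s))).
  rewrite mdotZl NN// mulr1 => <-; rewrite NE mdotZr n2E//; field.
  by rewrite gt_eqF ?n_gt0.
have k' s : I s -> derivable kappa s 1.
  move=> Is; have d2 := is_derive_mdot (a2' s Is) (a2' s Is).
  have ds := @is_derive1_comp _ Num.sqrt (fun t => mdot (a2 t) (a2 t)) s _ _
    (is_derive1_sqrt (a2_gt0 s Is)) d2.
  by apply: near_derivable oI Is _ ds => t It /=; rewrite kn// nE.
have N's s : I s -> is_derive s 1 N (N^`() s).
  move=> Is; apply: derivable_is_derive1.
  have k1 := is_deriveV (k0 s Is) (derivableP (k' s Is)).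
  apply: near_derivable oI Is _ (is_derive_scale k1 (a2' s Is)) => t It.
  by rewrite NE kn.
have N' s : I s -> is_derive s 1 N (kappa s *: T s + tau s *: B s).
  by move=> Is; have [_ _ <- _] := ct s Is; exact: N's.
have B's s (Is : I s) := is_derive_mcross (T' s Is) (N' s Is).
have B' s : I s -> is_derive s 1 B (- tau s *: N s).
  move=> Is; have [_ _ _ <-] := ct s Is; apply: derivable_is_derive1.
  by have [] := B's s Is.
have BB s : I s -> mdot (B s) (B s) = 1.
  by move=> Is; rewrite mdot_cross_cross TN// TT// NN//; ring.
(* Differentiate [a2 = kappa N] and pair with [B]: only the term [kappa tau] survives. The
   right-hand side is visibly derivable. *)
have tauE s : I s -> tau s = mdot (a3 s) (B s) / kappa s.
  move=> Is; apply: (canRL (mulfK (k0 s Is))).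
  have kN' := is_derive_scale (derivableP (k' s Is)) (N' s Is).
  have a3' : is_derive s 1 (fun t => kappa t *: N t) (a3 s).
    exact: near_is_derive oI Is a2N (a2' s Is).
  rewrite (is_derive_unique a3' kN') mdotDl (mdotZl _ (N s)).
  rewrite (mdotZl (kappa s)) mdotDl (mdotZl _ (T s)) (mdotZl _ (B s)).
  have TB : mdot (T s) (B s) = 0 by exact: mdot_crossl.
  have NB : mdot (N s) (B s) = 0 by exact: mdot_crossr.
  by rewrite BB// TB NB; ring.
have tau' s : I s -> derivable tau s 1.
  move=> Is.
  have a3' : is_derive s 1 a3 (a^`(4) s).
    by rewrite [a^`(4)]derive1nS; exact/derivable_is_derive1/smooth.
  have k1 := is_deriveV (k0 s Is) (derivableP (k' s Is)).
  have d3 := is_derive_mul (is_derive_mdot a3' (B' s Is)) k1.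
  by apply: near_derivable oI Is _ d3 => t It; rewrite tauE.
move=> s Is; split; [split| exact: k' | exact: tau' | by [] | split].
- by rewrite -(a2N s Is); exact: T'.
- exact: N'.
- exact: B'.
- exact: TT.
- exact: NN.
- exact: TN.
Qed.

End FrenetFrame.

(** * The slant invariant and its closed form *)

Section SlantHelix.
Context {R : realType}.
Implicit Types (I : set R) (kappa tau : R -> R) (s c e : R).

(** The constant is a value of [f]; on an empty [I] any number serves. *)
Lemma constant_onP I (f : R -> R) :
  (forall s t, I s -> I t -> f s = f t) -> constant_on I f.
Proof.
move=> fE; have [[s0 Is0]|I0] := pselect (exists s, I s).
  by exists (f s0) => s Is; exact: fE.
by exists 0 => s Is; exfalso; apply: I0; exists s.
Qed.

Lemma is_derive_ratio kappa tau s (dk dt : R) : kappa s != 0 ->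
  is_derive s 1 kappa dk -> is_derive s 1 tau dt ->
  kappa s ^+ 2 * (fun t => tau t / kappa t)^`()%classic s
    = dt * kappa s - tau s * dk.
Proof.
move=> k0 k' t'; rewrite derive1E.
have [_ ->] := is_derive_mul t' (is_deriveV k0 k').
by rewrite /GRing.scale /=; field.
Qed.

(** Turns the real power in the invariant into an integer power of a square root, so that [field]
    and [ring] apply. *)
Lemma powR32 (x : R) : 0 < x -> x `^ (3 / 2) = Num.sqrt x ^+ 3.
Proof.
move=> x0; have -> : (3 / 2 : R) = 1 + 2^-1 by field.
rewrite powRD ?gt_eqF ?implybT// powRr1 ?ltW// powR12_sqrt ?ltW//.
by rewrite exprSr sqr_sqrtr// ltW.
Qed.

(* The two functions of the theorem are the cases [e = 1] and [e = -1]. *)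
Definition slant_invariant e kappa tau s : R :=
  kappa s ^+ 2 / (e * (tau s ^+ 2 - kappa s ^+ 2)) `^ (3 / 2)
    * (fun t => tau t / kappa t)^`()%classic s.

Variables (I : set R) (T N B : R -> 'rV[R]_3) (kappa tau : R -> R) (e : R).
Hypotheses (I_open : open I) (I_itv : is_interval I).
Hypothesis frame : frenet_frame I T N B kappa tau.
Hypotheses (kappa_neq0 : forall s, I s -> kappa s != 0)
           (tau_neq0 : forall s, I s -> tau s != 0).
Hypotheses (e2 : e ^+ 2 = 1)
           (D_gt0 : forall s, I s -> 0 < e * (tau s ^+ 2 - kappa s ^+ 2)).

Let r s := Num.sqrt (e * (tau s ^+ 2 - kappa s ^+ 2)).

Let r_gt0 s : I s -> 0 < r s.
Proof. by move=> Is; rewrite sqrtr_gt0 D_gt0. Qed.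

Let r2E s : I s -> r s ^+ 2 = e * (tau s ^+ 2 - kappa s ^+ 2).
Proof. by move=> Is; rewrite sqr_sqrtr// ltW// D_gt0. Qed.

Let kappa' s : I s -> is_derive s 1 kappa ('D_1 kappa s).
Proof. by move=> /frame[_ ? _ _ _]; exact: derivableP. Qed.

Let tau' s : I s -> is_derive s 1 tau ('D_1 tau s).
Proof. by move=> /frame[_ _ ? _ _]; exact: derivableP. Qed.

Lemma slant_invariantE s : I s ->
  slant_invariant e kappa tau s =
  ('D_1 tau s * kappa s - tau s * 'D_1 kappa s) / r s ^+ 3.
Proof.
move=> Is; rewrite /slant_invariant powR32 ?D_gt0// mulrAC.
by rewrite (is_derive_ratio (kappa_neq0 Is) (kappa' Is) (tau' Is)).
Qed.

(** * From an axis to the constancy of the invariant *)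

Section Axis.
Variables (U : 'rV[R]_3) (c : R).
Hypotheses (U_neq0 : U != 0) (N_U : forall s, I s -> mdot (N s) U = c).

Let a s := mdot (T s) U.
Let b s := mdot (B s) U.

Let is_derive_mdotU (f : R -> 'rV[R]_3) s (df : 'rV[R]_3) :
  is_derive s 1 f df -> is_derive s 1 (fun t => mdot (f t) U) (mdot df U).
Proof.
move=> f'; apply: (is_derive_eq (is_derive_mdot f' (is_derive_cst U s 1))).
by rewrite -[0](scale0r U) mdotZr mul0r addr0.
Qed.

Let a' s : I s -> is_derive s 1 a (kappa s * c).
Proof.
move=> Is; have [[T' _ _] _ _ _ _] := frame Is.
by rewrite -(N_U Is) -mdotZl; exact: is_derive_mdotU.
Qed.

Let b' s : I s -> is_derive s 1 b (- tau s * c).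
Proof.
move=> Is; have [[_ _ B'] _ _ _ _] := frame Is.
by rewrite -(N_U Is) -mdotZl; exact: is_derive_mdotU.
Qed.

(** The left side is the derivative of the constant [mdot (N s) U]. *)
Let kappa_a_tau_b s : I s -> kappa s * a s + tau s * b s = 0.
Proof.
move=> Is; have [[_ N' _] _ _ _ _] := frame Is.
rewrite -!mdotZl -mdotDl; apply: is_derive_unique (is_derive_mdotU N') _.
apply: near_is_derive I_open Is _ (is_derive_cst c s 1) => t It.
exact/esym/N_U.
Qed.

(** The derivative of the previous relation, where the terms in [a'] and [b'] contribute
    [(kappa^2 - tau^2) c]. *)
Let kappa_a_tau_b' s : I s ->
  'D_1 kappa s * a s + 'D_1 tau s * b s = (tau s ^+ 2 - kappa s ^+ 2) * c.
Proof.
move=> Is.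
have d := is_deriveD (is_derive_mul (kappa' Is) (a' Is))
                     (is_derive_mul (tau' Is) (b' Is)).
have d0 : is_derive s 1 (fun t => kappa t * a t + tau t * b t) 0.
  apply: near_is_derive I_open Is _ (is_derive_cst 0 s 1) => t It.
  exact/esym/kappa_a_tau_b.
by have := is_derive_unique d d0; lra.
Qed.

Let bE s : I s -> b s = - kappa s * a s / tau s.
Proof.
move=> Is; apply: (canRL (mulfK (tau_neq0 Is))).
by have := kappa_a_tau_b Is; lra.
Qed.

(** If [a] vanished at [s], then so would [b] by [bE], and [c] by the differentiated relation since
    [tau^2 - kappa^2] is nonzero. Then [U] would be orthogonal to the whole frame. *)
Let a_neq0 s : I s -> a s != 0.
Proof.
move=> Is; apply: contra_neq U_neq0 => a0.
have b0 : b s = 0 by rewrite bE// a0 mulr0 mul0r.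
have c0 : c = 0.
  have /esym/eqP := kappa_a_tau_b' Is; rewrite a0 b0 !mulr0 addr0 mulf_eq0.
  by case/orP => [/eqP D0|/eqP//]; have := D_gt0 Is; rewrite D0 mulr0 ltxx.
have [_ _ _ BE [TT NN TN]] := frame Is.
apply: (@orthogonal_frame_eq0 _ (T s) (N s)) => //.
- by rewrite mdot_cross_cross TN TT NN !mulr1 expr0n sub0r opprK oner_neq0.
- by rewrite N_U.
- by rewrite -BE.
Qed.

Let g s := a s / tau s * r s.

Let g2E s : I s -> g s ^+ 2 = e * (a s ^+ 2 - b s ^+ 2).
Proof.
by move=> Is; rewrite bE// /g exprMn r2E//; field; exact: tau_neq0.
Qed.

(** The derivative computation only makes [g ^+ 2] constant. The sign of [g] is that of [a / tau],
    which is continuous and nonvanishing on the interval, so [g] itself is constant. *)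
Let g_cst s t : I s -> I t -> g s = g t.
Proof.
move=> Is It; have g2 : g s ^+ 2 = g t ^+ 2.
  rewrite !g2E//; congr (_ * _).
  apply: (derive0_constant_on I_itv (f := fun x => a x ^+ 2 - b x ^+ 2)) => //.
  move=> x Ix; apply: (is_derive_eq
    (is_deriveB (is_derive_sqr (a' Ix)) (is_derive_sqr (b' Ix)))).
  transitivity (2 * c * (kappa x * a x + tau x * b x)); first ring.
  by rewrite kappa_a_tau_b// mulr0.
have lam' x : I x ->
    is_derive x 1 (fun y => a y / tau y) ('D_1 (fun y => a y / tau y) x).
  move=> Ix; apply: derivableP.
  by have [] := is_derive_mul (a' Ix) (is_deriveV (tau_neq0 Ix) (tau' Ix)).
have lam_neq0 x : I x -> a x / tau x != 0.
  by move=> Ix; rewrite mulf_neq0 ?a_neq0// invr_eq0 tau_neq0.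
have [lam_gt0|lam_lt0] := continuous_neq0_sign I_itv
  (fun x Ix => is_derive_continuous (lam' x Ix)) lam_neq0.
  have g_ge0 x (Ix : I x) := ltW (mulr_gt0 (lam_gt0 x Ix) (r_gt0 Ix)).
  by apply/eqP; rewrite -(@eqrXn2 _ 2)// ?g_ge0// g2.
have g_ge0 x : I x -> 0 <= - g x.
  by move=> Ix; rewrite oppr_ge0 ltW// nmulr_rlt0 ?lam_lt0 ?r_gt0.
by apply/oppr_inj/eqP; rewrite -(@eqrXn2 _ 2) ?g_ge0// !sqrrN g2.
Qed.

Lemma slant_invariant_constant : constant_on I (slant_invariant e kappa tau).
Proof.
suff phiE : forall s, I s -> slant_invariant e kappa tau s = - e * c / g s.
  by apply: constant_onP => s t Is It; rewrite !phiE// (g_cst Is It).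
move=> s Is; rewrite slant_invariantE//.
have [a0 t0] := (a_neq0 Is, tau_neq0 Is).
have r0 : r s != 0 by rewrite gt_eqF ?r_gt0.
have := kappa_a_tau_b' Is; rewrite bE// => key.
(* Eliminating [b] from the differentiated relation gives [- (tau^2 - kappa^2) c tau / a]; the
   factor is written as [e r^2] by [e ^+ 2 = 1]. Division by [r^3] then leaves [- e c / g]. *)
have -> : 'D_1 tau s * kappa s - tau s * 'D_1 kappa s =
    - e * r s ^+ 2 * c * tau s / a s.
  rewrite r2E// [- e * _]mulrA mulNr -expr2 e2.
  apply: (mulIf a0); rewrite divfK//; apply: (mulIf (invr_neq0 t0)).
  have -> : - 1 * (tau s ^+ 2 - kappa s ^+ 2) * c * tau s / tau s
    = - ((tau s ^+ 2 - kappa s ^+ 2) * c) by field.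
  by rewrite -key; field.
by rewrite /g; field; rewrite a0 t0 r0.
Qed.

End Axis.

(** * From the constancy of the invariant to an axis *)

Lemma slant_axis c : (forall s, I s -> slant_invariant e kappa tau s = c) ->
  exists U, U != 0 /\ forall s, I s -> mdot (N s) U = - e * c.
Proof.
move=> phiE.
pose lam s := (r s)^-1.
(* The other direction determines the axis up to scale: normalising [g = 1] forces the products with
   [T], [N], [B] to be [tau lam], [- e c], [- kappa lam]. The coefficient of [T] has the opposite
   sign because [T] has square -1. *)
pose V s := - (tau s * lam s) *: T s + (- e * c) *: N s
            + - (kappa s * lam s) *: B s.
have r' s : I s -> is_derive s 1 r
    (e * (tau s * 'D_1 tau s - kappa s * 'D_1 kappa s) / r s).
  move=> Is; have D' := is_derive_mul (is_derive_cst e s 1)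
    (is_deriveB (is_derive_sqr (tau' Is)) (is_derive_sqr (kappa' Is))).
  apply: (is_derive_eq (@is_derive1_comp _ Num.sqrt
    (fun t => e * (tau t ^+ 2 - kappa t ^+ 2)) s _ _
    (is_derive1_sqrt (D_gt0 Is)) D')).
  by rewrite -/(r s) /cst; field; rewrite gt_eqF ?r_gt0.
have lam' s (Is : I s) := is_deriveV (lt0r_neq0 (r_gt0 Is)) (r' _ Is).
have cE s : I s ->
   c * r s ^+ 3 = 'D_1 tau s * kappa s - tau s * 'D_1 kappa s.
  move=> Is; rewrite -(phiE s Is) slant_invariantE// divfK//.
  by rewrite expf_neq0// gt_eqF ?r_gt0.
(* This and [kl'] are the equations [a' = kappa <N, U>] and [b' = - tau <N, U>] for the candidate
   axis. Multiplying by [r^3] reduces both to [cE]. *)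
have tl' s : I s -> is_derive s 1 (fun t => tau t * lam t) (- e * kappa s * c).
  move=> Is; apply: (is_derive_eq (is_derive_mul (tau' Is) (lam' _ Is))).
  have r0 : r s != 0 by rewrite gt_eqF ?r_gt0.
  apply: (mulIf (expf_neq0 3 r0)).
  transitivity ('D_1 tau s * r s ^+ 2
    - tau s * (e * (tau s * 'D_1 tau s - kappa s * 'D_1 kappa s))).
    by rewrite /lam /GRing.scale /=; field.
  by rewrite r2E// -[RHS]mulrA cE//; ring.
have kl' s : I s -> is_derive s 1 (fun t => kappa t * lam t) (- e * tau s * c).
  move=> Is; apply: (is_derive_eq (is_derive_mul (kappa' Is) (lam' _ Is))).
  have r0 : r s != 0 by rewrite gt_eqF ?r_gt0.
  apply: (mulIf (expf_neq0 3 r0)).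
  transitivity ('D_1 kappa s * r s ^+ 2
    - kappa s * (e * (tau s * 'D_1 tau s - kappa s * 'D_1 kappa s))).
    by rewrite /lam /GRing.scale /=; field.
  by rewrite r2E// -[RHS]mulrA cE//; ring.
have V' s : I s -> is_derive s 1 V 0.
  move=> Is; have [[T' N' B'] _ _ _ _] := frame Is.
  have ntl' : is_derive s 1 (fun t => - (tau t * lam t)) _ :=
    is_deriveN (tl' s Is).
  have nkl' : is_derive s 1 (fun t => - (kappa t * lam t)) _ :=
    is_deriveN (kl' s Is).
  have d1 := is_derive_scale ntl' T'.
  have d2 := is_derive_scale (is_derive_cst (- e * c) s 1) N'.
  have d3 := is_derive_scale nkl' B'.
  apply: (is_derive_eq (is_deriveD (is_deriveD d1 d2) d3)).
  by apply/rowP => j; rewrite !mxE /cst; ring.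
have VE s t : I s -> I t -> V s = V t.
  move=> Is It; apply/rowP => j.
  apply: (derive0_constant_on I_itv (f := fun x => V x 0 j)) => // x Ix.
  by have /is_derive_rowP/(_ j) := V' x Ix; rewrite mxE.
have NV s : I s -> mdot (N s) (V s) = - e * c.
  move=> Is; have [_ _ _ BE [TT NN TN]] := frame Is.
  rewrite /V !mdotDr !mdotZr NN [mdot (N s) (T s)]mdotC TN BE mdot_crossr.
  ring.
(* On an empty [I] any nonzero vector is an axis. *)
have [[s0 Is0]|I0] := pselect (exists s, I s); last first.
  exists (const_mx 1); split; last by move=> s Is; exfalso; apply: I0; exists s.
  by apply/eqP => /rowP/(_ 0); rewrite !mxE => /eqP; rewrite oner_eq0.
exists (V s0); split; last by move=> s Is; rewrite -(VE s)// NV.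
have [_ _ _ BE [TT NN TN]] := frame Is0.
(* This product is nonzero, so [V s0] is nonzero too. *)
have TV : mdot (T s0) (V s0) = tau s0 * lam s0.
  by rewrite /V !mdotDr !mdotZr TT TN BE mdot_crossl; ring.
apply: contra_neq (tau_neq0 Is0) => V0; move: TV.
rewrite V0 -(scale0r (T s0)) mdotZr mul0r => /esym/eqP.
by rewrite mulf_eq0 invr_eq0 [r s0 == 0]gt_eqF ?r_gt0// orbF => /eqP.
Qed.

End SlantHelix.

(** * The equivalence, assembled from the two signs of [e] *)

Theorem theorem1p2 (R : realType) (I : set R)
    (I_open : open I) (I_itv : is_interval I)
    (alpha : R -> 'rV[R]_3) (kappa tau : R -> R)
    (alpha_timelike : timelike_curve I alpha)
    (alpha_unit : unit_speed I alpha)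
    (alpha_frenet : curvature_torsion I alpha kappa tau)
    (kappa_neq0 : forall s, I s -> kappa s != 0)
    (tau_neq0 : forall s, I s -> tau s != 0)
    (tau_kappa_neq0 : forall s, I s -> tau s ^+ 2 - kappa s ^+ 2 != 0) :
  slant_helix I alpha <->
  ((forall s, I s -> kappa s ^+ 2 < tau s ^+ 2) /\
   constant_on I (fun s =>
     kappa s ^+ 2 / (tau s ^+ 2 - kappa s ^+ 2) `^ (3 / 2)
       * ((fun t => tau t / kappa t)^`() s)%classic))
  \/
  ((forall s, I s -> tau s ^+ 2 < kappa s ^+ 2) /\
   constant_on I (fun s =>
     kappa s ^+ 2 / (kappa s ^+ 2 - tau s ^+ 2) `^ (3 / 2)
       * ((fun t => tau t / kappa t)^`() s)%classic)).
Proof.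
have frame := frenet_frameP I_open alpha_timelike alpha_unit alpha_frenet
  kappa_neq0.
have slantE e : e ^+ 2 = 1 ->
    (forall s, I s -> 0 < e * (tau s ^+ 2 - kappa s ^+ 2)) ->
    slant_helix I alpha <-> constant_on I (slant_invariant e kappa tau).
  move=> e2 D_gt0; split=> [[U [U0 [c NU]]]|[c phiE]].
    exact: (slant_invariant_constant I_open I_itv frame kappa_neq0 tau_neq0 e2
      D_gt0 U0 NU).
  have [U [U0 NU]] := slant_axis I_itv frame kappa_neq0 tau_neq0 D_gt0 phiE.
  by exists U; split=> //; exists (- e * c).
have slant1 : slant_invariant 1 kappa tau = fun s =>
    kappa s ^+ 2 / (tau s ^+ 2 - kappa s ^+ 2) `^ (3 / 2)
       * ((fun t => tau t / kappa t)^`() s)%classic.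
  by apply/funext => s; rewrite /slant_invariant mul1r.
have slantN1 : slant_invariant (-1) kappa tau = fun s =>
    kappa s ^+ 2 / (kappa s ^+ 2 - tau s ^+ 2) `^ (3 / 2)
       * ((fun t => tau t / kappa t)^`() s)%classic.
  by apply/funext => s; rewrite /slant_invariant mulN1r opprB.
have slant1E : (forall s, I s -> kappa s ^+ 2 < tau s ^+ 2) ->
    slant_helix I alpha <-> constant_on I (slant_invariant 1 kappa tau).
  move=> lt; apply: slantE; rewrite ?expr1n// => s Is.
  by rewrite mul1r subr_gt0 lt.
have slantN1E : (forall s, I s -> tau s ^+ 2 < kappa s ^+ 2) ->
    slant_helix I alpha <-> constant_on I (slant_invariant (-1) kappa tau).
  move=> lt; apply: slantE; rewrite ?sqrrN ?expr1n// => s Is.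
  by rewrite mulN1r opprB subr_gt0 lt.
rewrite -slant1 -slantN1; split=> [slant|[[lt]|[lt]]]; last 2 first.
- by rewrite slant1E.
- by rewrite slantN1E.
(* Derivability gives continuity, so the nonvanishing [tau^2 - kappa^2] keeps one sign on [I]; that
   sign selects the disjunct. *)
have D' s : I s -> is_derive s 1 (fun t => tau t ^+ 2 - kappa t ^+ 2)
    (2 * tau s * 'D_1 tau s - 2 * kappa s * 'D_1 kappa s).
  move=> /frame[_ k' t' _ _].
  exact: is_deriveB (is_derive_sqr (derivableP t'))
    (is_derive_sqr (derivableP k')).
have [D_gt0|D_lt0] := continuous_neq0_sign I_itv
  (fun s Is => is_derive_continuous (D' s Is)) tau_kappa_neq0.
- have lt s : I s -> kappa s ^+ 2 < tau s ^+ 2 by move=> /D_gt0; rewrite subr_gt0.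
  by left; rewrite -slant1E.
- have lt s : I s -> tau s ^+ 2 < kappa s ^+ 2 by move=> /D_lt0; rewrite subr_lt0.
  by right; rewrite -slantN1E.
Qed.
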